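(* Let $n\ge1$. If $b\in\Delta_n=\{1,2,4,7\}^n$ and $b\ne e_n$, where $e_n=77\cdots7$, then the set $C_{\mathrm{tiles}}(b)=\{c\in\Delta_n:cb=bc\}$ satisfies $$|C_{\mathrm{tiles}}(b)|=\frac{4^n}{2}.$$ In particular, $C_{\mathrm{tiles}}(b)$ contains exactly one half of the $4^n$ words in $\Delta_n$.
   Context: Digits are identified with quaternionic symbols: $1=i$, $2=j$, $4=k$, $7=e$, where $e$ is the identity, $i^2=j^2=k^2=-e$, $ij=k=-ji$, $jk=i=-kj$, $ki=j=-ik$. Words in $\Delta_n$ are multiplied coordinate by coordinate, with the local quaternionic signs collected into one global sign, so that the product of two words is an element of $\{\pm d:d\in\Delta_n\}$. The words of $\Delta_n$ label the tiles of the order-$n$ tiling. *)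

(* Defs.v *)
From HB Require Import structures.
From mathcomp Require Import all_boot all_order all_algebra.

Set Implicit Arguments.
Unset Strict Implicit.
Unset Printing Implicit Defensive.

(* The digits 1, 2, 4, 7, read as the quaternionic symbols i, j, k, e. *)
Inductive digit : Type := D1 | D2 | D4 | D7.

Definition nat_of_digit (d : digit) : nat :=
  match d with D1 => 1 | D2 => 2 | D4 => 4 | D7 => 7 end.

Definition digit_of_nat (m : nat) : option digit :=
  match m with
  | 1 => Some D1 | 2 => Some D2 | 4 => Some D4 | 7 => Some D7 | _ => None
  end.

Lemma nat_of_digitK : pcancel nat_of_digit digit_of_nat.
Proof. by case. Qed.

HB.instance Definition _ := Countable.copy digit (pcan_type nat_of_digitK).

Lemma digit_enumP : Finite.axiom [:: D1; D2; D4; D7].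
Proof. by case. Qed.

HB.instance Definition _ := isFinite.Build digit digit_enumP.

(* A pair (s, x) stands for the signed symbol -x if s = true, +x otherwise. *)
Definition digit_mul (x y : digit) : bool * digit :=
  match x, y with
  | D7, d  => (false, d)
  | d,  D7 => (false, d)
  | D1, D1 => (true, D7)
  | D2, D2 => (true, D7)
  | D4, D4 => (true, D7)
  | D1, D2 => (false, D4)
  | D2, D1 => (true,  D4)
  | D2, D4 => (false, D1)
  | D4, D2 => (true,  D1)
  | D4, D1 => (false, D2)
  | D1, D4 => (true,  D2)
  end.

Notation Delta n := (n.-tuple digit).

Definition e_word (n : nat) : Delta n := nseq_tuple n D7.

(* The global sign is the product of the local signs: with true = minus,
   that is the exclusive or of the local sign bits. *)
Definition word_mul (n : nat) (u v : Delta n) : bool * Delta n :=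
  (\big[addb/false]_(i < n) (digit_mul (tnth u i) (tnth v i)).1,
   [tuple (digit_mul (tnth u i) (tnth v i)).2 | i < n]).

(* The equality compares signed words, so it includes the global sign. *)
Definition C_tiles (n : nat) (b : Delta n) : {set Delta n} :=
  [set c : Delta n | word_mul c b == word_mul b c].

(* Main.v *)
(* Swapping the factors of a product of words changes the sign by the product
   of the local commutation signs, and each of these is multiplicative in its
   first argument.  If the i-th digit of b is not e, some digit d anticommutes
   with it; multiplying the i-th digit of c by d (signs dropped) is an
   involution of the set of words that exchanges the words commuting with b and
   those anticommuting with it, so both classes have 4^n / 2 elements. *)
Require Import Defs.
From mathcomp Require Import all_boot all_order all_algebra.

Set Implicit Arguments.
Unset Strict Implicit.
Unset Printing Implicit Defensive.

(** Sign bit of the commutator of [x] and [y]; with [(+)] these bits add up over the coordinates of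
    a word. *)
Definition anticomm (x y : digit) : bool :=
  (digit_mul x y).1 (+) (digit_mul y x).1.

Lemma digit_mulC2 x y : (digit_mul x y).2 = (digit_mul y x).2.
Proof. by case: x; case: y. Qed.

(** Up to sign, every symbol squares to [D7]. *)
Lemma digit_mulK2 d : involutive (fun x => (digit_mul x d).2).
Proof. by case: d => -[]. Qed.

(** Signs are central, so conjugation by [y] is multiplicative and the sign dropped from the product
    of [x] and [d] has no effect. *)
Lemma anticommMl x d y :
  anticomm (digit_mul x d).2 y = anticomm x y (+) anticomm d y.
Proof. by case: x; case: d; case: y. Qed.

Lemma exists_anticomm y : y != D7 -> exists d, anticomm d y.
Proof. by case: y => // _; [exists D2 | exists D1 | exists D1]. Qed.

Lemma card_digit : #|{: digit}| = 4.
Proof. by rewrite cardE enumT unlock. Qed.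

Lemma in_C_tiles n (b c : Delta n) :
  (c \in C_tiles b) = ~~ \big[addb/false]_(i < n) anticomm (tnth c i) (tnth b i).
Proof.
rewrite inE /word_mul big_split /=.
(* Without signs the two products agree, so only the global signs remain to be compared. *)
have -> : [tuple (digit_mul (tnth c i) (tnth b i)).2 | i < n] =
          [tuple (digit_mul (tnth b i) (tnth c i)).2 | i < n].
  by apply: eq_from_tnth => i; rewrite !tnth_mktuple digit_mulC2.
by rewrite xpair_eqE eqxx andbT; do 2 case: (\big[_/_]_(_ < _) _).
Qed.

Definition mul_digit_at n (i : 'I_n) (d : digit) (c : Delta n) : Delta n :=
  [tuple if j == i then (digit_mul (tnth c j) d).2 else tnth c j | j < n].

Lemma mul_digit_atK n (i : 'I_n) d : involutive (mul_digit_at i d).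
Proof.
move=> c; apply: eq_from_tnth => j; rewrite !tnth_mktuple.
by case: (j == i); rewrite ?digit_mulK2.
Qed.

Lemma mul_digit_at_C_tiles n (i : 'I_n) d (b c : Delta n) :
  anticomm d (tnth b i) -> (mul_digit_at i d c \in C_tiles b) = (c \notin C_tiles b).
Proof.
(* Only the [i]-th summand differs between the two sides, and [d] flips it. *)
move=> dP; rewrite !in_C_tiles negbK (bigD1 i) //= [in RHS](bigD1 i) //=.
rewrite tnth_mktuple eqxx anticommMl dP addbT addNb negbK.
by congr (_ (+) _); apply: eq_bigr => j /negPf ji; rewrite tnth_mktuple ji.
Qed.

Lemma card_C_tiles n (b : Delta n) :
  b <> e_word n -> 2 * #|C_tiles b| = #|{: Delta n}|.
Proof.
move=> hb; have [i bi] : exists i, tnth b i != D7.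
  apply/existsP; apply: contra_notT hb => /existsPn b7.
  apply: eq_from_tnth => i; move: (b7 i); rewrite negbK => /eqP ->.
  by rewrite (tnth_nth D7) nth_nseq ltn_ord.
have [d dP] := exists_anticomm bi.
have fC : mul_digit_at i d @^-1: C_tiles b = ~: C_tiles b.
  by apply/setP => c; rewrite in_setC -(mul_digit_at_C_tiles _ dP) !inE.
rewrite -(cardsC (C_tiles b)) -fC card_preimset ?mul2n ?addnn //.
exact: inv_inj (mul_digit_atK i d).
Qed.

Theorem corollary6p6 (n : nat) (hn : (1 <= n)%N) (b : Delta n)
    (hb : b <> e_word n) :
  (#|C_tiles b|%:R = 4%:R ^+ n / 2%:R :> rat)%R /\
  (#|{: Delta n}| = 4 ^ n /\ 2 * #|C_tiles b| = #|{: Delta n}|)%N.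
Proof.
have cD : #|{: Delta n}| = 4 ^ n by rewrite card_tuple card_digit.
have cC := card_C_tiles hb; split=> //.
by rewrite -GRing.natrX -cD -cC mulnC GRing.natrM GRing.mulfK.
Qed.
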